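(* Let $X, Y$ be non-zero ordered normed spaces and assume that the cone $X_+$ is total (hence the wedge $\mathcal{L}(X,Y)_+$ of positive bounded linear operators is a cone). The following are equivalent: (i) The cone $\mathcal{L}(X,Y)_+$ has non-empty interior in $\mathcal{L}(X,Y)$ (with respect to the operator norm). (ii) The cone $Y_+$ has non-empty interior in $Y$ and there exists an equivalent norm on $X$ which is additive on $X_+$. If these equivalent assertions are satisfied, then the interior of $\mathcal{L}(X,Y)_+$ contains a rank-$1$ operator; more specifically, for every interior point $y_0$ of $Y_+$ and every interior point $x_0'$ of $X'_+$, the rank-$1$ operator $y_0 \otimes x_0'$ is an interior point of $\mathcal{L}(X,Y)_+$.
   Context: All vector spaces are real. A wedge in a real vector space $V$ is a non-empty subset $V_+$ with $\alpha V_+ + \beta V_+ \subseteq V_+$ for all real $\alpha,\beta \ge 0$; it is a cone if in addition $V_+ \cap (-V_+) = \{0\}$. One writes $x \le y$ if $y - x \in V_+$. An ordered normed space is a normed space $X$ (not necessarily complete) endowed with a norm closed cone $X_+$. The cone $X_+$ is total if its linear span is norm dense in $X$. $\mathcal{L}(X,Y)$ is the space of bounded linear operators from $X$ to $Y$ with the operator norm, and $\mathcal{L}(X,Y)_+ = \{T \in \mathcal{L}(X,Y) : T[X_+] \subseteq Y_+\}$. The norm dual is denoted by $X'$, and $X'_+ = \{x' \in X' : \langle x', x\rangle \ge 0 \text{ for all } x \in X_+\}$; interior points of $X'_+$ are meant with respect to the dual norm. A norm $\|\cdot\|$ on $X$ is additive on $X_+$ if $\|x_1 + x_2\| = \|x_1\|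 + \|x_2\|$ for all $x_1, x_2 \in X_+$. For $y \in Y$ and $x' \in X'$, $y \otimes x' : X \to Y$ is the operator $x \mapsto \langle x', x\rangle\, y$. *)

(* Defs.v *)
From HB Require Import structures.
From mathcomp Require Import all_boot all_order all_algebra.
From mathcomp Require Import all_classical all_reals all_analysis.

Set Implicit Arguments.
Unset Strict Implicit.
Unset Printing Implicit Defensive.

Import Order.TTheory GRing.Theory Num.Theory.
Import numFieldNormedType.Exports.

Local Open Scope classical_set_scope.
Local Open Scope ring_scope.

Section cones.
Context (R : realType).

Definition wedge (V : lmodType R) (C : set V) : Prop :=
  C !=set0 /\
  forall (a b : R) (x y : V),
    0 <= a -> 0 <= b -> C x -> C y -> C (a *: x + b *: y).

Definition cone (V : lmodType R) (C : set V) : Prop :=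
  wedge C /\ C `&` [set - x | x in C] = [set 0].

(* The normed space X, ordered by x <= y iff y - x \in C, is an ordered normed
   space. *)
Definition ordered_normed_space (X : normedModType R) (C : set X) : Prop :=
  cone C /\ closed C.

Definition linear_span (V : lmodType R) (C : set V) : set V :=
  [set x | exists (n : nat) (a : 'I_n -> R) (v : 'I_n -> V),
     (forall i, C (v i)) /\ x = \sum_(i < n) a i *: v i].

Definition total_cone (X : normedModType R) (C : set X) : Prop :=
  dense (linear_span C).

Definition is_norm (V : lmodType R) (N : V -> R) : Prop :=
  [/\ forall x, 0 <= N x,
      forall x, N x = 0 -> x = 0,
      forall (a : R) x, N (a *: x) = `|a| * N x &
      forall x y, N (x + y) <= N x + N y].

Definition equivalent_norm (X : normedModType R) (N : X -> R) : Prop :=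
  is_norm N /\
  exists c d : R, [/\ 0 < c, 0 < d &
    forall x, c * `|x| <= N x /\ N x <= d * `|x|].

Definition additive_on (V : lmodType R) (C : set V) (N : V -> R) : Prop :=
  forall x y, C x -> C y -> N (x + y) = N x + N y.

End cones.

Definition bounded_linear_pred (R : realType) (X Y : normedModType R) :
    {pred X -> Y} :=
  mem [set f : X -> Y | linear f /\ exists M : R, forall x, `|f x| <= M * `|x|].

Record bounded_linear (R : realType) (X Y : normedModType R) := BoundedLinear {
  bounded_linear_fun :> X -> Y ;
  bounded_linear_funP : bounded_linear_fun \in @bounded_linear_pred R X Y }.

Section bounded_linear_lmodType.
Context (R : realType) (X Y : normedModType R).
Local Notation L := (bounded_linear X Y).

HB.instance Definition _ := [isSub for @bounded_linear_fun R X Y].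
HB.instance Definition _ := [Choice of L by <:].

Lemma bounded_linear_submod_closed :
  submod_closed (@bounded_linear_pred R X Y).
Proof.
split=> [|a f g].
  rewrite inE; split=> [b x y /=|]; first by rewrite scaler0 addr0.
  by exists 0 => x /=; rewrite normr0 mul0r.
rewrite !inE => -[lf [M fM]] [lg [N gN]]; split=> [b x y|].
  have -> z : (a *: f + g) z = a *: f z + g z by [].
  by rewrite lf lg !scalerDr !scalerA [b * a]mulrC addrACA.
exists (`|a| * M + N) => x.
have -> : (a *: f + g) x = a *: f x + g x by [].
rewrite (le_trans (ler_normD _ _))// normrZ mulrDl lerD// -mulrA.
by rewrite ler_wpM2l.
Qed.

HB.instance Definition _ :=
  GRing.isSubmodClosed.Build R (X -> Y) (@bounded_linear_pred R X Y)
    bounded_linear_submod_closed.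
HB.instance Definition _ := [SubChoice_isSubLmodule of L by <:].

Lemma bounded_linear_linear (T : L) : linear T.
Proof. by have := bounded_linear_funP T; rewrite inE => -[]. Qed.

HB.instance Definition _ (T : L) :=
  GRing.isLinear.Build R X Y *:%R T (bounded_linear_linear T).

Lemma bounded_linear_bounded (T : L) :
  exists2 M : R, 0 <= M & forall x, `|T x| <= M * `|x|.
Proof.
have := bounded_linear_funP T; rewrite inE => -[_ [M TM]].
exists `|M| => // x; rewrite (le_trans (TM x))// ler_wpM2r//.
exact: ler_norm.
Qed.

Definition operator_norm (T : L) : R :=
  sup [set `|T x| | x in [set x : X | `|x| <= 1]].

Lemma operator_norm_has_sup (T : L) :
  has_sup [set `|T x| | x in [set x : X | `|x| <= 1]].
Proof.
split; first by exists `|T 0|, 0 => //=; rewrite normr0.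
have [M M0 TM] := bounded_linear_bounded T.
exists M => _ [x /= x1 <-]; rewrite (le_trans (TM x))//.
by rewrite -[leRHS]mulr1 ler_wpM2l.
Qed.

Lemma operator_norm_ge_unit (T : L) x : `|x| <= 1 -> `|T x| <= operator_norm T.
Proof.
move=> x1; apply: sup_upper_bound; first exact: operator_norm_has_sup.
by exists x.
Qed.

Lemma operator_norm_ge0 (T : L) : 0 <= operator_norm T.
Proof.
by rewrite (le_trans _ (@operator_norm_ge_unit T 0 _))// normr0.
Qed.

Lemma operator_norm_le (T : L) (M : R) :
  (forall x, `|x| <= 1 -> `|T x| <= M) -> operator_norm T <= M.
Proof.
move=> TM; apply: ge_sup; first by have [] := operator_norm_has_sup T.
by move=> _ [x /= x1 <-]; exact: TM.
Qed.

Lemma ler_operator_norm (T : L) x : `|T x| <= operator_norm T * `|x|.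
Proof.
have [->|x0] := eqVneq x 0; first by rewrite linear0 !normr0 mulr0.
have nx : 0 < `|x| by rewrite normr_gt0.
have := @operator_norm_ge_unit T (`|x|^-1 *: x).
rewrite linearZ/= !normrZ normfV normr_id mulVf ?gt_eqF// => /(_ (lexx _)).
by rewrite mulrC ler_pdivrMr.
Qed.

Lemma bounded_linearD (S T : L) x : (S + T) x = S x + T x.
Proof. by []. Qed.

Lemma bounded_linearZ (a : R) (T : L) x : (a *: T) x = a *: T x.
Proof. by []. Qed.

Lemma operator_normD (S T : L) :
  operator_norm (S + T) <= operator_norm S + operator_norm T.
Proof.
apply: operator_norm_le => x x1; rewrite bounded_linearD.
by rewrite (le_trans (ler_normD _ _))// lerD// operator_norm_ge_unit.
Qed.

Lemma operator_normZ (a : R) (T : L) :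
  operator_norm (a *: T) = `|a| * operator_norm T.
Proof.
apply/eqP; rewrite eq_le; apply/andP; split.
  apply: operator_norm_le => x x1; rewrite bounded_linearZ normrZ.
  by rewrite ler_wpM2l// operator_norm_ge_unit.
have [->|a0] := eqVneq a 0; first by rewrite normr0 mul0r operator_norm_ge0.
rewrite mulrC -ler_pdivlMr ?normr_gt0//; apply: operator_norm_le => x x1.
rewrite ler_pdivlMr ?normr_gt0// mulrC -normrZ -bounded_linearZ.
exact: operator_norm_ge_unit.
Qed.

Lemma operator_norm_eq0 (T : L) : operator_norm T = 0 -> T = 0.
Proof.
move=> T0; apply/val_inj/funext => x /=; apply/eqP; rewrite -normr_le0.
by have := ler_operator_norm T x; rewrite T0 mul0r.
Qed.

HB.instance Definition _ := @Lmodule_isNormed.Build R L operator_norm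
  operator_normD operator_normZ operator_norm_eq0.

End bounded_linear_lmodType.

Section positive_operators.
Context (R : realType) (X Y : normedModType R).

Definition positive_operators (XC : set X) (YC : set Y) :
    set (bounded_linear X Y) :=
  [set T | forall x, XC x -> YC (T x)].

Definition dual_wedge (XC : set X) : set (bounded_linear X R^o) :=
  [set f | forall x, XC x -> 0 <= (f x : R)].

Lemma tensor_subproof (y : Y) (f : bounded_linear X R^o) :
  (fun x => (f x : R) *: y) \in @bounded_linear_pred R X Y.
Proof.
rewrite inE; split=> [a u v|]; first by rewrite linearP scalerDl scalerA.
have [M M0 fM] := bounded_linear_bounded f; exists (M * `|y|) => x.
by rewrite normrZ mulrAC ler_wpM2r.
Qed.

Definition tensor (y : Y) (f : bounded_linear X R^o) : bounded_linear X Y :=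
  BoundedLinear (tensor_subproof y f).

(* the range of T is one-dimensional *)
Definition rank_one (T : bounded_linear X Y) : Prop :=
  exists2 y : Y, y != 0 & range T = [set a *: y | a in [set: R]].

End positive_operators.

(* Main.v *)
Require Import Defs.
From mathcomp Require Import all_boot all_order all_algebra.
From mathcomp Require Import all_classical all_reals all_analysis.
From mathcomp Require Import lra.

Set Implicit Arguments.
Unset Strict Implicit.
Unset Printing Implicit Defensive.

Import Order.TTheory GRing.Theory Num.Theory.
Import numFieldNormedType.Exports.
Local Open Scope classical_set_scope.
Local Open Scope ring_scope.

(** The bridge between the two conditions is a bounded functional [f] on [X]
with [c * `|x| <= f x] on the cone of [X], for some [c > 0].

Such an [f] exists exactly when [X] has an equivalent norm that is additive on
the cone.  Given [f], the norm [max `|f x| (c * `|x|)] coincides with [f] on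
the cone ([additive_norm_of_functional]).  Given the norm [N], a Hahn-Banach
argument yields a linear [f <= N] with [N <= f] on the cone
([functional_of_additive_norm]).

If [y] is an interior point of the cone of [Y], then [tensor y f] is an
interior point of the positive operators: a perturbation [S] changes the value
[f x *: y] by at most [`|S| * `|x| <= (`|S| / c) * f x], and [y] absorbs a
change of relative size [`|S| / c] ([tensor_interior]).

Conversely, let [T] be an interior point of the positive operators.  Perturbing
[T] by rank-one operators [tensor y g], with [g] a functional of norm at most
one that attains the norm of a chosen [x], gives two facts.  If [x] is a
nonzero point of the cone, then [T x] absorbs every small [y], so it is an
interior point of the cone of [Y] ([interior_positive_range]).  If instead [y]
is a small positive multiple of a fixed [u] and [h] is a positive functional
with [h u > 0], then applying [h] to [T x - `|x| *: y >= 0] shows that the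
composite [h \o T] is a functional [f] as above
([interior_positive_functional]).  Taking [Y] to be the scalars, the same
perturbation shows that interior points of the dual wedge are such functionals
too ([interior_dual_lower_bound]), hence the final claim on [tensor y0 f0].

All functionals come from one Hahn-Banach theorem, [sublinear_sandwich]: if [p]
is sublinear and [D] is a wedge of pairs [(v, r)] with [r <= p v], some linear
[f <= p] satisfies [r <= f v] on [D]. *)

(** * Wedges *)

Section wedges.
Context (R : realType) (V : lmodType R).

Lemma wedge_add (C : set V) x y : wedge C -> C x -> C y -> C (x + y).
Proof.
by move=> [_ CP] Cx Cy; rewrite -[x]scale1r -[y]scale1r; apply: CP.
Qed.

Lemma wedge_scale (C : set V) (a : R) x :
  wedge C -> 0 <= a -> C x -> C (a *: x).
Proof.
by move=> [_ CP] a0 Cx; rewrite -[_ *: _]addr0 -[0](scale0r x); apply: CP.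
Qed.

Lemma wedge0 (C : set V) : wedge C -> C 0.
Proof.
by move=> CP; have [x Cx] := CP.1; rewrite -(scale0r x); exact: wedge_scale.
Qed.

Lemma wedge_ray (d : V) : wedge [set t *: d | t in [set t : R | 0 <= t]].
Proof.
split=> [|a b _ _ a0 b0 [s /= s0 <-] [t /= t0 <-]].
  by exists 0, 0 => //=; rewrite ?scale0r.
by exists (a * s + b * t); rewrite ?scalerDl ?scalerA//= addr_ge0// mulr_ge0.
Qed.

End wedges.

(** * A Hahn-Banach sandwich theorem *)

Section sandwich.
Context (R : realType) (V : lmodType R).

Definition sublinear (p : V -> R) : Prop :=
  (forall x y, p (x + y) <= p x + p y) /\
  (forall (a : R) x, 0 <= a -> p (a *: x) = a * p x).

Lemma sublinear0 p : sublinear p -> p 0 = 0.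
Proof. by move=> [_ pZ]; rewrite -(scale0r 0) pZ// mul0r. Qed.

Lemma sublinear_geN p x : sublinear p -> - p (- x) <= p x.
Proof.
move=> psub; rewrite lerNl -subr_ge0 opprK -(sublinear0 psub) -(addNr x).
exact: psub.1.
Qed.

(** Covers both infima needed below: that of a chain of sublinear functions, and
that of the translates [fun x => p (x + v) - r] in [reduct].  The members of
the family need not be sublinear, only jointly so up to passing to another
member. *)
Lemma sublinear_inf (I : Type) (A : set I) (F : I -> V -> R) (p : V -> R) :
  A !=set0 -> sublinear p ->
  (forall i x, A i -> - p (- x) <= F i x) ->
  (forall i j x y, A i -> A j ->
     exists2 k, A k & F k (x + y) <= F i x + F j y) ->
  (forall i (a : R) x, A i -> 0 < a ->
     exists2 k, A k & F k (a *: x) <= a * F i x) ->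
  sublinear (fun x => inf [set F i x | i in A]) /\
  forall i x, A i -> inf [set F i x | i in A] <= F i x.
Proof.
move=> [i0 Ai0] psub Fp FD FZ; pose q x := inf [set F i x | i in A].
have qF i x : A i -> q x <= F i x.
  move=> Ai; apply: ge_inf; last by exists i.
  by exists (- p (- x)) => _ [j Aj <-]; exact: Fp.
have le_q r x : (forall i, A i -> r <= F i x) -> r <= q x.
  move=> rF; apply: lb_le_inf; first by exists (F i0 x), i0.
  by move=> _ [i Ai <-]; exact: rF.
have qZ (a : R) x : 0 < a -> q (a *: x) <= a * q x.
  move=> a0; rewrite mulrC -ler_pdivrMr//; apply: (le_q _ _) => i Ai.
  have [k Ak kF] := FZ i a x Ai a0.
  by rewrite ler_pdivrMr// mulrC (le_trans _ kF)// qF.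
split=> //; split=> [x y|a x].
  rewrite -/(q _) -/(q x) -/(q y) -lerBlDr; apply: (le_q _ _) => i Ai.
  rewrite lerBlDr -lerBlDl; apply: (le_q _ _) => j Aj; rewrite lerBlDl.
  have [k Ak kF] := FD i j x y Ai Aj.
  by rewrite (le_trans _ kF)// qF.
rewrite -/(q _) -/(q x) le_eqVlt => /predU1P[<-|a0].
  rewrite scale0r mul0r; apply/eqP; rewrite eq_le; apply/andP; split.
    have := qZ 2^-1 0; rewrite scaler0 invr_gt0 => /(_ (ltr0Sn _ _)) h.
    by rewrite -/(q 0); lra.
  apply: (le_q _ _) => i Ai; have := Fp i 0 Ai.
  by rewrite oppr0 (sublinear0 psub) oppr0.
apply/eqP; rewrite eq_le qZ//= -ler_pdivlMl//.
by rewrite (le_trans _ (qZ _ _ _)) ?invr_gt0// scalerA mulVf ?gt_eqF// scale1r.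
Qed.

(** At [- d.1] its value is at most [p 0 - d.2], so a linear function below it
is at least [d.2] at [d.1]. *)
Definition reduct (D : set (V * R^o)) (p : V -> R) (x : V) : R :=
  inf [set p (x + d.1) - d.2 | d in D].

Lemma reduct_sublinear (D : set (V * R^o)) (p : V -> R) :
  sublinear p -> wedge D -> (forall d, D d -> d.2 <= p d.1) ->
  sublinear (reduct D p) /\
  forall d x, D d -> reduct D p x <= p (x + d.1) - d.2.
Proof.
move=> psub Dw Dp.
apply: (@sublinear_inf _ D (fun d x => p (x + d.1) - d.2) p) => //.
- exact: Dw.1.
- move=> d x Dd; rewrite lerBrDr addrC lerBlDr (le_trans (Dp _ Dd))//.
  by rewrite -{1}(addKr x d.1) addrC; exact: psub.1.
- move=> d e x y Dd De; exists (d + e); first exact: wedge_add.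
  by rewrite /= addrACA opprD [leRHS]addrACA lerD2r; exact: psub.1.
- move=> d a x Dd a0; exists (a *: d).
    by apply: wedge_scale => //; exact: ltW.
  have -> : p (a *: x + (a *: d).1) = a * p (x + d.1).
    by rewrite -scalerDr psub.2// ltW.
  by rewrite mulrBr.
Qed.

(** Zorn's lemma for the reversed order: the infimum of a chain is finite
because a sublinear [q <= p] satisfies [- p (- x) <= - q (- x) <= q x]. *)
Lemma exists_minimal_sublinear (p : V -> R) : sublinear p ->
  exists2 q, sublinear q /\ (forall x, q x <= p x) &
    forall q', sublinear q' -> (forall x, q' x <= q x) ->
      forall x, q x <= q' x.
Proof.
move=> psub; pose T := {q : V -> R | sublinear q /\ forall x, q x <= p x}.
pose below (q q' : T) := `[< forall x, sval q' x <= sval q x >].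
have p_p : sublinear p /\ forall x, p x <= p x by [].
have [//|r s t|A Atot|[q [qsub qp]] qmin] :=
  ZL_preorder (exist _ p p_p : T) (R := below).
- by move=> t; apply/asboolP.
- by move=> /asboolP rs /asboolP st; apply/asboolP => x; apply: le_trans (rs x).
- have [A0|/set0P A0] := eqVneq A set0.
    by exists (exist _ p p_p) => s; rewrite A0.
  have [t x At|s t x y As At|t a x At a0|qsub qF] :=
      @sublinear_inf T A (fun t => sval t) p A0 psub.
  + rewrite (le_trans _ (sublinear_geN x (svalP t).1))// lerN2.
    exact: (svalP t).2.
  + have [/asboolP st|/asboolP ts] := Atot _ _ As At.
      by exists t => //; rewrite (le_trans ((svalP t).1.1 _ _))// lerD2r.
    by exists s => //; rewrite (le_trans ((svalP s).1.1 _ _))// lerD2l.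
  + by exists t; rewrite // (svalP t).1.2// ltW.
  have [t0 At0] := A0.
  have qp x : inf [set sval t x | t in A] <= p x.
    by rewrite (le_trans (qF _ _ At0))//; exact: (svalP t0).2.
  exists (exist _ (fun x => inf [set sval t x | t in A]) (conj qsub qp)).
  by move=> s As; apply/asboolP => x; exact: qF.
exists q => // q' q'sub q'q.
have q'p x : q' x <= p x by exact: le_trans (qp x).
have := qmin (exist _ q' (conj q'sub q'p)).
by move=> /(_ (asboolT q'q))/asboolP.
Qed.

(** Reducing [q] along the ray through [(y, q y)] cannot lower it, which gives
[q x <= q (x + y) - q y]; with subadditivity, [q] is additive. *)
Lemma minimal_sublinear_linear (q : V -> R) : sublinear q ->
  (forall q', sublinear q' -> (forall x, q' x <= q x) ->
    forall x, q x <= q' x) ->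
  linear (q : V -> R^o).
Proof.
move=> qsub qmin.
have qD x y : q (x + y) = q x + q y.
  apply/eqP; rewrite eq_le qsub.1/= -lerBrDr.
  pose D := [set t *: ((y, q y) : V * R^o) | t in [set t : R | 0 <= t]].
  have Dw : wedge D by exact: wedge_ray.
  have Dq d : D d -> d.2 <= q d.1 by move=> [t /= t0 <-]; rewrite /= qsub.2.
  have [rsub rq] := reduct_sublinear qsub Dw Dq.
  have Dy : D (y, q y) by exists 1 => //=; rewrite scale1r.
  rewrite (le_trans _ (rq (y, q y) x Dy))//; apply: qmin => // z.
  by rewrite (le_trans (rq 0 z (wedge0 Dw)))//= addr0 subr0.
have qN x : q (- x) = - q x.
  by apply/eqP; rewrite -addr_eq0 -qD addNr sublinear0.
move=> a x y; rewrite qD; congr (_ + _).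
have [a0|/ltW a0] := leP 0 a; first exact: qsub.2.
by rewrite -[a]opprK scaleNr qN qsub.2 ?oppr_ge0// scaleNr.
Qed.

(** The Mazur-Orlicz form of the Hahn-Banach theorem: [f] is a minimal
sublinear function below [reduct D p]. *)
Theorem sublinear_sandwich (D : set (V * R^o)) (p : V -> R) :
  sublinear p -> wedge D -> (forall d, D d -> d.2 <= p d.1) ->
  exists f : V -> R^o, [/\ linear f, forall x, f x <= p x &
    forall d, D d -> d.2 <= f d.1].
Proof.
move=> psub Dw Dp; have [rsub rp] := reduct_sublinear psub Dw Dp.
have [f [fsub fr] fmin] := exists_minimal_sublinear rsub.
exists f; split=> [|x|d Dd]; first exact: minimal_sublinear_linear.
  by rewrite (le_trans (fr x))// (le_trans (rp 0 x (wedge0 Dw)))// addr0 subr0.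
rewrite (le_trans _ (sublinear_geN _ fsub))// lerNr (le_trans (fr _))//.
by rewrite (le_trans (rp d _ Dd))// addNr sublinear0// sub0r.
Qed.

End sandwich.

(** * Functionals on normed spaces *)

Section normed.
Context (R : realType).
Implicit Types X Y : normedModType R.

Lemma interior_normP X (A : set X) (x : X) :
  interior A x <-> exists2 e : R, 0 < e & forall z, `|z| < e -> A (x + z).
Proof.
rewrite /interior; split=> [/nbhs_ballP[e /= e0 eA]|[e e0 eA]].
  exists e => // z ze; apply: eA; rewrite -ball_normE /=.
  by rewrite opprD addNKr normrN.
apply/nbhs_ballP; exists e => //= y; rewrite -ball_normE /= => xy.
by rewrite -(subrK x y) addrC; apply: eA; rewrite distrC.
Qed.

Lemma closed_dist_gt0 X (C : set X) (x : X) : closed C -> ~ C x ->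
  exists2 d : R, 0 < d & forall c, C c -> d <= `|x - c|.
Proof.
move=> /closed_openC; rewrite openE => Copen Cx.
have /interior_normP[d d0 dC] := Copen x Cx.
exists d => // c Cc; rewrite leNgt; apply/negP => cd.
by apply: (dC (c - x)); rewrite 1?distrC// addrC subrK.
Qed.

Lemma norm_sublinear X : sublinear (fun x : X => `|x|).
Proof.
by split=> [x y|a x a0]; [exact: ler_normD | rewrite normrZ ger0_norm].
Qed.

Lemma bounded_sandwich X (D : set (X * R^o)) (p : X -> R) (M : R) :
  sublinear p -> (forall x, p x <= M * `|x|) ->
  wedge D -> (forall d, D d -> d.2 <= p d.1) ->
  exists f : bounded_linear X R^o,
    [/\ forall x, `|f x| <= M * `|x|, forall x, (f x : R) <= p x &
        forall d, D d -> d.2 <= (f d.1 : R)].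
Proof.
move=> psub pM Dw Dp; have [f [flin fp Df]] := sublinear_sandwich psub Dw Dp.
have fM x : `|f x| <= M * `|x|.
  have fN : - f x = f (- x).
    have := flin (- 1) x 0; rewrite addr0 scaleN1r => ->.
    have := flin (-1) 0 0; rewrite scaler0 addr0 => ->.
    by rewrite !scaleN1r addNr addr0.
  rewrite ler_norml (le_trans (fp x))// andbT lerNl fN (le_trans (fp _))//.
  by rewrite -(normrN x).
have fbl : f \in @bounded_linear_pred R X R^o.
  by rewrite inE; split=> //; exists M.
by exists (BoundedLinear fbl).
Qed.

(** The sandwich theorem for the norm and the ray through [(x, `|x|)]. *)
Lemma norming_functional X (x : X) :
  exists2 g : bounded_linear X R^o, forall z, `|g z| <= `|z| & g x = `|x|.
Proof.
have [|d|g [gn gle gx]] := @bounded_sandwich X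
  [set t *: ((x, `|x|) : X * R^o) | t in [set t : R | 0 <= t]] _ 1
  (norm_sublinear X) _ (wedge_ray _).
- by move=> z; rewrite mul1r.
- by move=> [t /= t0 <-]; rewrite /= normrZ ger0_norm.
exists g => [z|]; first by rewrite -[leRHS]mul1r.
apply/eqP; rewrite eq_le gle/=; apply: (gx (x, `|x|)).
by exists 1 => //=; rewrite scale1r.
Qed.

Lemma cone_pointed (V : lmodType R) (C : set V) x :
  cone C -> C x -> C (- x) -> x = 0.
Proof.
move=> [_ CN] Cx CNx; suff : (C `&` [set - y | y in C]) x by rewrite CN.
by split=> //; exists (- x); rewrite ?opprK.
Qed.

(** Since the cone is pointed, [- u] lies outside it, at distance at least some
[d > 0].  Hence [t * d <= `|c + t *: u|] for [c] in the cone and [t >= 0], which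
is what the sandwich theorem needs to produce [h] with [0 <= h c] and
[d <= h u]. *)
Lemma positive_functional Y (C : set Y) (u : Y) :
  cone C -> closed C -> C u -> u != 0 ->
  exists2 h : bounded_linear Y R^o, dual_wedge C h & 0 < (h u : R).
Proof.
move=> Ccone Cclosed Cu u0.
have [d d0 dC] : exists2 d : R, 0 < d & forall c, C c -> d <= `|- u - c|.
  apply: closed_dist_gt0 => // CNu; move/eqP: u0; apply.
  exact: cone_pointed Ccone Cu CNu.
(* The ray through [(u, d)], added to the cone placed at height zero. *)
pose D := [set z : Y * R^o |
  exists c t, [/\ C c, 0 <= t & z = (c + t *: u, t * d)]].
have C0 := wedge0 Ccone.1.
have Dw : wedge D.
  split=> [|a b _ _ a0 b0 [c [t [Cc t0 ->]]] [c' [t' [Cc' t'0 ->]]]].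
    by exists (0 + 0 *: u, 0 * d), 0, 0.
  exists (a *: c + b *: c'), (a * t + b * t'); split.
  - exact: Ccone.1.2.
  - by rewrite addr_ge0// mulr_ge0.
  - congr (_, _); first by rewrite /= !scalerDr !scalerA scalerDl addrACA.
    by rewrite /= mulrDl -!mulrA.
have [|_ [c [t [Cc t0 ->]]] /=|h [_ _ Dh]] := @bounded_sandwich Y D _ 1
  (norm_sublinear Y) _ Dw.
- by move=> z; rewrite mul1r.
- move: t0; rewrite le_eqVlt => /predU1P[<-|t0]; first by rewrite mul0r.
  have Ctc : C (t^-1 *: c).
    by apply: wedge_scale Ccone.1 _ Cc; rewrite invr_ge0 ltW.
  have -> : c + t *: u = - t *: (- u - t^-1 *: c).
    rewrite scalerBr !scaleNr scalerN opprK scalerA mulfV ?gt_eqF//.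
    by rewrite scale1r opprK addrC.
  by rewrite normrZ normrN gtr0_norm// ler_wpM2l ?(ltW t0)//; exact: dC.
exists h => [c Cc|].
  by apply: (Dh (c, 0)); exists c, 0; rewrite scale0r addr0 mul0r.
apply: (lt_le_trans d0); apply: (Dh (u, d)).
by exists 0, 1; rewrite scale1r add0r mul1r.
Qed.

(** * Total cones and the cone of positive operators *)

Lemma total_cone_neq0 X (C : set X) :
  (exists x : X, x != 0) -> total_cone C -> exists2 x, C x & x != 0.
Proof.
move=> [x x0] Ctot.
have [//||y [/= y0 [n [a [v [Cv yE]]]]]] := Ctot (~` [set 0]).
- by exists x; apply/eqP.
- exact/closed_openC/accessible_closed_set1/hausdorff_accessible/norm_hausdorff.
have [i vi] : exists i, v i != 0.
  apply: contrapT => /forallNP v0; apply: y0; rewrite /= yE big1// => i _.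
  by move/negP/negPn/eqP: (v0 i) => ->; rewrite scaler0.
by exists (v i).
Qed.

Lemma total_cone_eq0 X Y (C : set X) (T : bounded_linear X Y) :
  total_cone C -> (forall x, C x -> T x = 0) -> T = 0.
Proof.
move=> Ctot TC; apply/val_inj/funext => x /=; apply/eqP/negPn/negP => Tx0.
have [M M0 TM] := bounded_linear_bounded T.
have e0 : 0 < `|T x| / (M + 1) by rewrite divr_gt0 ?normr_gt0 ?ltr_wpDl.
have [|//|z [xz [n [a [v [Cv zE]]]]]] := Ctot (ball x (`|T x| / (M + 1))).
- by exists x; exact: ballxx.
- exact: ball_open.
have Tz : T z = 0.
  rewrite zE linear_sum big1// => i _.
  by rewrite linearZ /= TC ?scaler0.
move: xz; rewrite -ball_normE /= ltr_pdivlMr ?ltr_wpDl// ltNge => /negP; apply.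
have := TM (x - z); rewrite linearB /= Tz subr0 => /le_trans; apply.
by rewrite mulrC ler_wpM2l// lerDl.
Qed.

Lemma positive_operators_cone X Y (C : set X) (K : set Y) :
  total_cone C -> cone K -> cone (positive_operators C K).
Proof.
move=> Ctot Kc; have K0 := wedge0 Kc.1; split.
  split=> [|a b S T a0 b0 SP TP x Cx]; first by exists 0 => x.
  by apply: Kc.1.2; [| |exact: SP|exact: TP].
apply/seteqP; split=> [T [TP [S SP ST]]|_ ->]; last first.
  by split=> [x //|]; exists 0; rewrite ?oppr0// => x.
apply: (total_cone_eq0 Ctot) => x Cx; apply: (cone_pointed Kc); first exact: TP.
by rewrite -ST opprK; exact: SP.
Qed.

Lemma interior_neq0 Y (K : set Y) (u : Y) : (exists y : Y, y != 0) ->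
  cone K -> interior K u -> u != 0.
Proof.
move=> [y y0] Kc; apply: contraPneq => -> /interior_normP[e e0 eK].
have ny : 0 < `|y| by rewrite normr_gt0.
pose z := (e / 2 / `|y|) *: y.
have nz : `|z| < e.
  rewrite normrZ gtr0_norm ?divr_gt0// mulfVK ?gt_eqF//.
  by rewrite ltr_pdivrMr// ltr_pMr// ltr1n.
have : z = 0.
  apply: (cone_pointed Kc); rewrite -[X in K X]add0r; apply: eK => //.
  by rewrite normrN.
move=> /eqP; rewrite scaler_eq0 (negbTE y0) orbF.
by rewrite !mulf_eq0 !invr_eq0 (gt_eqF e0) (gt_eqF ny) pnatr_eq0.
Qed.

(** * Interior points of the cone of positive operators *)

Lemma operator_norm_tensor_le X Y (y : Y) (g : bounded_linear X R^o) :
  (forall z, `|g z| <= `|z|) -> `|tensor y g| <= `|y|.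
Proof.
move=> g1; apply: operator_norm_le => x x1 /=.
by rewrite normrZ ler_piMl// (le_trans (g1 x)).
Qed.

(** For [x] in [C], dividing by [f x] turns [f x *: y + S x] into a point
at distance at most [`|S| / c] from [y]. *)
Lemma tensor_interior X Y (C : set X) (K : set Y) (y : Y)
    (f : bounded_linear X R^o) (c : R) :
  wedge K -> 0 < c -> (forall x, C x -> c * `|x| <= (f x : R)) ->
  interior K y -> interior (positive_operators C K) (tensor y f).
Proof.
move=> Kw c0 fc /interior_normP[r r0 rK]; apply/interior_normP.
exists (r * c); first exact: mulr_gt0.
move=> S Src x Cx; rewrite bounded_linearD /=.
have [->|x0] := eqVneq x 0.
  by rewrite !linear0 scale0r addr0; exact: wedge0.
have fx0 : 0 < (f x : R).
  by rewrite (lt_le_trans _ (fc x Cx))// mulr_gt0// normr_gt0.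
have -> : (f x : R) *: y + S x = (f x : R) *: (y + (f x : R)^-1 *: S x).
  by rewrite scalerDr scalerA mulfV ?gt_eqF// scale1r.
apply: wedge_scale Kw (ltW fx0) _; apply: rK.
rewrite normrZ normfV gtr0_norm// ltr_pdivrMl//.
rewrite (le_lt_trans (ler_operator_norm S x))//.
rewrite (@lt_le_trans _ _ (r * c * `|x|))// ?ltr_pM2r ?normr_gt0//.
by rewrite -mulrA mulrC ler_pM2r// fc.
Qed.

(** A small multiple of a functional norming [x] may be subtracted from [f]
without leaving the dual wedge. *)
Lemma interior_dual_lower_bound X (C : set X) (f : bounded_linear X R^o) :
  interior (dual_wedge C) f ->
  exists2 c : R, 0 < c & forall x, C x -> c * `|x| <= (f x : R).
Proof.
move=> /interior_normP[e e0 eC]; exists (e / 2); first by rewrite divr_gt0.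
move=> x Cx; have [g g1 gx] := norming_functional x.
rewrite -subr_ge0 -mulNr.
have := eC (- (e / 2) *: g) _ x Cx.
rewrite bounded_linearD bounded_linearZ gx; apply.
rewrite normrZ normrN gtr0_norm ?divr_gt0//.
rewrite (@le_lt_trans _ _ (e / 2))//; last first.
  by rewrite ltr_pdivrMr// ltr_pMr// ltr1n.
rewrite ger_pMr ?divr_gt0//.
by apply: operator_norm_le => z z1; rewrite (le_trans (g1 z)).
Qed.

Lemma rank_one_tensor X Y (y : Y) (f : bounded_linear X R^o) (x : X) :
  y != 0 -> (f x : R) != 0 -> rank_one (tensor y f).
Proof.
move=> y0 fx0; exists y => //; apply/seteqP; split=> [_ [z _ <-]|_ [a _ <-]].
  by exists (f z).
exists ((a / (f x : R)) *: x) => //=.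
by rewrite linearZ; congr (_ *: y); exact: divfK.
Qed.

(** Every small [y] is a value at [x] of a small rank-one operator, built from a
functional norming [x]. *)
Lemma interior_positive_range X Y (C : set X) (K : set Y)
    (T : bounded_linear X Y) (x : X) :
  C x -> x != 0 -> interior (positive_operators C K) T -> interior K (T x).
Proof.
move=> Cx x0 /interior_normP[e e0 eT]; apply/interior_normP.
have nx : 0 < `|x| by rewrite normr_gt0.
exists (e * `|x|) => [|y ye]; first exact: mulr_gt0.
have [g g1 gx] := norming_functional x.
have := eT (tensor (`|x|^-1 *: y) g) _ x Cx.
rewrite bounded_linearD /= gx scalerA mulfV ?gt_eqF// scale1r; apply.
rewrite (le_lt_trans (operator_norm_tensor_le _ g1))//.
by rewrite normrZ normfV normr_id ltr_pdivrMl// mulrC.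
Qed.

(** The functional is [h \o T], with [h] positive and [h u > 0]: for small
[s > 0] the operator [T] minus [tensor (s *: u) g] is positive whichever
functional [g] of norm at most one is used, and the choice of [g] norming [x]
gives [s * h u * `|x| <= h (T x)]. *)
Lemma interior_positive_functional X Y (C : set X) (K : set Y)
    (T : bounded_linear X Y) (u : Y) :
  cone K -> closed K -> K u -> u != 0 ->
  interior (positive_operators C K) T ->
  exists (f : bounded_linear X R^o) (c : R),
    0 < c /\ forall x, C x -> c * `|x| <= (f x : R).
Proof.
move=> Kc Kcl Ku u0 /interior_normP[e e0 eT].
have [h hK hu] := positive_functional Kc Kcl Ku u0.
have nu : 0 < `|u| by rewrite normr_gt0.
have hTbl : (h \o T) \in @bounded_linear_pred R X R^o.
  rewrite inE; split=> [a x y /=|]; first by rewrite !linearP.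
  exists (operator_norm h * operator_norm T) => x /=.
  rewrite (le_trans (ler_operator_norm h _))// -mulrA.
  by rewrite ler_wpM2l ?operator_norm_ge0// ler_operator_norm.
have [s s0 su] : exists2 s : R, 0 < s & s * `|u| < e.
  exists (e / 2 / `|u|); first by rewrite !divr_gt0.
  by rewrite mulfVK ?gt_eqF// ltr_pdivrMr// ltr_pMr// ltr1n.
exists (BoundedLinear hTbl), (s * (h u : R)); split; first exact: mulr_gt0.
move=> x Cx /=; have [g g1 gx] := norming_functional x.
have := hK _ (eT (tensor (- s *: u) g) _ x Cx).
rewrite bounded_linearD /= gx linearD !linearZ /= => hTx.
have : 0 <= (h (T x) : R) + `|x| * (- s * (h u : R)).
  apply: hTx; rewrite (le_lt_trans (operator_norm_tensor_le _ g1))//.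
  by rewrite normrZ normrN gtr0_norm.
by rewrite mulNr mulrN subr_ge0 mulrC.
Qed.

(** * Additive norms and functionals *)

(** The maximum with [c * `|x|] makes the seminorm [`|f x|] a norm equivalent to
the given one, without changing it on the cone. *)
Lemma additive_norm_of_functional X (C : set X) (f : bounded_linear X R^o)
    (c : R) : wedge C -> 0 < c -> (forall x, C x -> c * `|x| <= (f x : R)) ->
  exists N : X -> R, equivalent_norm N /\ additive_on C N.
Proof.
move=> Cw c0 fc; exists (fun x => Num.max `|f x| (c * `|x|)).
have [M M0 fM] := bounded_linear_bounded f.
split; last first.
  have fE x : C x -> Num.max `|f x| (c * `|x|) = (f x : R).
    move=> Cx; have cf := fc x Cx.
    rewrite ger0_norm; first exact/max_idPl.
    by rewrite (le_trans _ cf)// mulr_ge0// ltW.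
  move=> x y Cx Cy; rewrite !fE// ?linearD//.
  exact: wedge_add.
split.
  split.
  - by move=> x; rewrite le_max normr_ge0.
  - move=> x Nx; apply/eqP; rewrite -normr_eq0 eq_le normr_ge0 andbT.
    by rewrite -(pmulr_rle0 _ c0) -Nx le_max lexx orbT.
  - move=> a x; rewrite linearZ !normrZ mulrCA.
    by rewrite maxr_pMr.
  - move=> x y; rewrite ge_max linearD.
    rewrite (le_trans (ler_normD _ _)) ?lerD ?le_max ?lexx//=.
    rewrite (@le_trans _ _ (c * `|x| + c * `|y|)) ?lerD ?le_max ?lexx ?orbT//.
    by rewrite -mulrDr ler_pM2l// ler_normD.
exists c, (M + c); split=> [//||x]; first by rewrite ltr_wpDl.
have cx : 0 <= c * `|x| by rewrite mulr_ge0// ltW.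
split; first by rewrite le_max lexx orbT.
by rewrite ge_max mulrDl ler_wpDr//= ler_wpDl// mulr_ge0.
Qed.

(** For a homogeneous [N], additivity makes the graph of [N] over the cone a
wedge, so the sandwich theorem extends [N] from the cone to a functional
below [N]. *)
Lemma functional_of_additive_norm X (C : set X) (N : X -> R) :
  wedge C -> equivalent_norm N -> additive_on C N ->
  exists (f : bounded_linear X R^o) (c : R),
    0 < c /\ forall x, C x -> c * `|x| <= (f x : R).
Proof.
move=> Cw [[_ _ NZ ND] [c [d [c0 d0 cd]]]] Nadd.
have Nsub : sublinear N by split=> // a x a0; rewrite NZ ger0_norm.
pose D := [set ((x, N x) : X * R^o) | x in C].
have Dw : wedge D.
  split=> [|a b _ _ a0 b0 [x Cx <-] [y Cy <-]].
    by exists (0, N 0), 0 => //; exact: wedge0.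
  exists (a *: x + b *: y); first exact: Cw.2.
  by congr (_, _); rewrite Nadd ?Nsub.2//; exact: wedge_scale.
have [x|_ [x Cx <-]//|f [_ _ Df]] :=
  bounded_sandwich (M := d) Nsub _ Dw; first by have [] := cd x.
exists f, c; split=> // x Cx; rewrite (le_trans (proj1 (cd x)))//.
by apply: (Df (x, N x)); exists x.
Qed.

End normed.

(** * Cones of positive operators with non-empty interior *)

Theorem theorem4p1 (R : realType) (X Y : normedModType R)
  (X_nonzero : exists x : X, x != 0) (Y_nonzero : exists y : Y, y != 0)
  (Xplus : set X) (Yplus : set Y)
  (X_ordered : ordered_normed_space Xplus)
  (Y_ordered : ordered_normed_space Yplus)
  (X_total : total_cone Xplus) :
  [/\ cone (positive_operators Xplus Yplus),
      (interior (positive_operators Xplus Yplus) !=set0 <->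
       (interior Yplus !=set0 /\
        exists N : X -> R, equivalent_norm N /\ additive_on Xplus N)) &
      (interior (positive_operators Xplus Yplus) !=set0 ->
       (exists T : bounded_linear X Y,
          rank_one T /\ interior (positive_operators Xplus Yplus) T) /\
       (forall (y0 : Y) (f0 : bounded_linear X R^o),
          interior Yplus y0 -> interior (dual_wedge Xplus) f0 ->
          rank_one (tensor y0 f0) /\
          interior (positive_operators Xplus Yplus) (tensor y0 f0)))].
Proof.
have [[Xw Xpt] Xcl] := X_ordered; have [Yc Ycl] := Y_ordered.
have [x Xx x0] := total_cone_neq0 X_nonzero X_total.
have tensorP (y : Y) (f : bounded_linear X R^o) (c : R) :
    0 < c -> (forall x, Xplus x -> c * `|x| <= (f x : R)) ->
    interior Yplus y ->
    rank_one (tensor y f) /\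
    interior (positive_operators Xplus Yplus) (tensor y f).
  move=> c0 fc yint; split; last exact: tensor_interior Yc.1 c0 fc yint.
  apply: (@rank_one_tensor _ _ _ _ _ x); first exact: interior_neq0 Yc yint.
  by rewrite gt_eqF// (lt_le_trans _ (fc x Xx))// mulr_gt0// normr_gt0.
have cone_interior T : interior (positive_operators Xplus Yplus) T ->
    interior Yplus (T x) /\ exists (f : bounded_linear X R^o) (c : R),
      0 < c /\ forall x, Xplus x -> c * `|x| <= (f x : R).
  move=> Tint; have Txint := interior_positive_range Xx x0 Tint; split=> //.
  apply: (interior_positive_functional Yc Ycl _ _ Tint).
    exact: interior_subset Txint.
  exact: interior_neq0 Yc Txint.
split; first exact: positive_operators_cone.
- split=> [[T /cone_interior[Txint [f [c [c0 fc]]]]]|].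
    split; first by exists (T x).
    exact: additive_norm_of_functional Xw c0 fc.
  move=> [[y yint] [N [Neq Nadd]]].
  have [f [c [c0 fc]]] := functional_of_additive_norm Xw Neq Nadd.
  by exists (tensor y f); have [] := tensorP y f c c0 fc yint.
- move=> [T /cone_interior[Txint [f [c [c0 fc]]]]]; split.
    by exists (tensor (T x) f); exact: tensorP c0 fc Txint.
  move=> y0 f0 y0int /interior_dual_lower_bound[c' c'0 f0c].
  exact: tensorP c'0 f0c y0int.
Qed.
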